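(* Let $X_n$ be the unitary Cayley graph of order $n$. Then the adjacency matrix of $L^2(X_n)=L(L(X_n))$ has exactly four distinct eigenvalues if and only if $n$ is a prime greater than $3$, or $n$ is a power of $2$ greater than $4$, or $n=6$.
   Context: The unitary Cayley graph $X_n$ is the graph with vertex set $\mathbb{Z}_n=\{0,1,\ldots,n-1\}$ in which $i$ and $j$ are adjacent if and only if $\gcd(i-j,n)=1$. The line graph $L(G)$ of a graph $G$ has the edges of $G$ as vertices, two being adjacent if the corresponding edges share a vertex; $L^2(G)=L(L(G))$. *)

(* Defs.v *)
From HB Require Import structures.
From mathcomp Require Import all_boot all_order all_algebra.

Set Implicit Arguments.
Unset Strict Implicit.
Unset Printing Implicit Defensive.

Import Order.TTheory GRing.Theory Num.Theory.
Local Open Scope ring_scope.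

Record sgraph := SGraph {
  vertex : finType;
  adj : rel vertex;
  adj_sym : symmetric adj;
  adj_irr : irreflexive adj
}.

Section UnitaryCayley.
Variable n : nat.

(* The difference is taken in int; its gcd with n depends only on i - j mod n.
   The conjunct i != j only matters for n = 1, where gcd(0, 1) = 1 would
   otherwise put a loop at the single vertex. *)
Definition ucayley_adj : rel 'I_n :=
  fun i j => (i != j) && (gcdz (i%:Z - j%:Z) n%:Z == 1).

Lemma ucayley_adj_sym : symmetric ucayley_adj.
Proof. by move=> i j; rewrite /ucayley_adj eq_sym -opprB gcdNz. Qed.

Lemma ucayley_adj_irr : irreflexive ucayley_adj.
Proof. by move=> i; rewrite /ucayley_adj eqxx. Qed.

Definition unitary_cayley : sgraph := SGraph ucayley_adj_sym ucayley_adj_irr.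

End UnitaryCayley.

Section LineGraph.
Variable G : sgraph.

Definition edges : {set {set vertex G}} :=
  [set e | [exists x, exists y, adj x y && (e == [set x; y])]].

Definition edge : finType := {e : {set vertex G} | e \in edges}.

Definition line_adj : rel edge :=
  fun e f => (e != f) && (val e :&: val f != set0).

Lemma line_adj_sym : symmetric line_adj.
Proof. by move=> e f; rewrite /line_adj eq_sym setIC. Qed.

Lemma line_adj_irr : irreflexive line_adj.
Proof. by move=> e; rewrite /line_adj eqxx. Qed.

Definition line_graph : sgraph := SGraph line_adj_sym line_adj_irr.

End LineGraph.

Definition adjacency_matrix (F : fieldType) (G : sgraph) :
    'M[F]_#|vertex G| :=
  \matrix_(i, j) (adj (enum_val i) (enum_val j))%:R.

Definition has_exactly_distinct_eigenvalues (F : fieldType) (m : nat)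
    (A : 'M[F]_m) (k : nat) : Prop :=
  exists s : seq F,
    [/\ uniq s, size s = k & forall a : F, eigenvalue A a = (a \in s)].

(* Main.v *)
Require Import Defs.
From mathcomp Require Import all_boot all_order all_algebra.
From mathcomp Require Import zify ring.

(** Let B be the vertex-edge incidence matrix of an r-regular graph G. Then
    B B^T = A(G) + r and B^T B = A(L(G)) + 2 have the same nonzero eigenvalues,
    and for r >= 3 there are more edges than vertices, so 0 is an eigenvalue of
    B^T B. Applying this twice, for r >= 3 the spectrum of L^2(G), shifted by
    6 - 3r, is Spec(G) together with -r and 4 - 3r; for r = 2 the spectra of G
    and L^2(G) coincide.

    In X_n we have r = phi(n), and x, y are adjacent iff y - x is a unit of
    Z/n. The values r, -r and 4 - 3r always occur in the shifted spectrum, and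
    so does -r/(p-1) for each prime p | n (character of order p). A second
    odd prime q, the value 0 for a proper odd prime power, or the symmetry of
    the spectrum of a bipartite graph for n even then produces a fifth value.
    When n is prime or a power of 2 the spectrum of X_n is {r, -1} or
    {r, -r, 0}. Finally phi(n) <= 2 only for n = 1, 2, 3, 4, 6. *)

Set Implicit Arguments.
Unset Strict Implicit.
Unset Printing Implicit Defensive.

Import Order.TTheory GRing.Theory Num.Theory.
Local Open Scope ring_scope.

(** * Incidence matrices and line graphs *)

Definition degree (G : sgraph) (x : vertex G) : nat := (\sum_y adj x y)%N.

Definition regular (G : sgraph) (r : nat) := forall x : vertex G, degree x = r.

Section Incidence.
Variable G : sgraph.
Implicit Types (x y : vertex G) (e f : edge G).
Local Open Scope nat_scope.

Definition inc x e : nat := x \in val e.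

Lemma edgeP e : exists x y, adj x y /\ val e = [set x; y].
Proof.
have := valP e; rewrite inE => /existsP[x /existsP[y /andP[xy /eqP ->]]].
by exists x, y.
Qed.

Lemma card_edge e : #|val e| = 2.
Proof.
have [x [y [xy ->]]] := edgeP e; rewrite cards2.
by case: eqP xy => // ->; rewrite adj_irr.
Qed.

Lemma mem_edges x y : ([set x; y] \in edges G) = adj x y.
Proof.
rewrite inE; apply/existsP/idP => [[a /existsP[b /andP[ab /eqP E]]]|xy]; last first.
  by exists x; apply/existsP; exists y; rewrite xy eqxx.
have nab : a != b by apply: contraTneq ab => ->; rewrite adj_irr.
have : a \in [set x; y] by rewrite E set21.
have : b \in [set x; y] by rewrite E set22.
rewrite !inE; case/orP=> /eqP Eb; case/orP=> /eqP Ea;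
  move: ab nab; rewrite Ea Eb ?eqxx // => ab _.
by rewrite adj_sym.
Qed.

Lemma sum_inc_edge e : \sum_x inc x e = 2.
Proof.
rewrite -(card_edge e) -sum1_card [RHS]big_mkcond; apply: eq_bigr => x _.
by rewrite /inc; case: (_ \in _).
Qed.

Lemma edge_eq_pair x y e :
  x != y -> (x \in val e) && (y \in val e) = (val e == [set x; y]).
Proof.
move=> nxy; apply/idP/eqP => [/andP[xe ye]|->]; last by rewrite set21 set22.
apply/esym/eqP; rewrite eqEcard cards2 nxy card_edge andbT.
by apply/subsetP=> z; rewrite !inE => /orP[]/eqP->.
Qed.

Lemma sum_inc2_edges_neq x y :
  x != y -> \sum_e inc x e * inc y e = adj x y.
Proof.
move=> nxy; rewrite -mem_edges.
under eq_bigr => e _ do rewrite /inc mulnb edge_eq_pair //.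
have [xyE|xyE] := boolP (_ \in edges G).
  rewrite (bigD1 (exist (fun s => s \in edges G) [set x; y] xyE : edge G)) //=.
  rewrite eqxx big1 // => e.
  by rewrite -val_eqE /= => /negbTE->.
rewrite big1 // => e _; case: eqP => // E.
by rewrite -E (valP e) in xyE.
Qed.

(* Counting the pairs (e, y) with x, y in e in two ways gives
   2 d(x) = d(x) + degree x, where d(x) is the number of edges through x. *)
Lemma sum_inc_vertex x : \sum_e inc x e = degree x.
Proof.
have E : \sum_y \sum_e inc x e * inc y e = (\sum_e inc x e) * 2.
  rewrite exchange_big big_distrl /=; apply: eq_bigr => e _.
  by rewrite -big_distrr /= sum_inc_edge.
have D : \sum_(y | y != x) \sum_e inc x e * inc y e = degree x.
  rewrite /degree [in RHS](bigD1 x) //= adj_irr add0n.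
  by apply: eq_bigr => y nyx; rewrite sum_inc2_edges_neq // eq_sym.
have I : \sum_e inc x e * inc x e = \sum_e inc x e.
  by apply: eq_bigr => e _; rewrite /inc mulnb andbb.
by move: E; rewrite (bigD1 x) //= D I muln2 -addnn => /addnI ->.
Qed.

Lemma sum_inc2_edges x y :
  \sum_e inc x e * inc y e = adj x y + (x == y) * degree x.
Proof.
case: (eqVneq x y) => [<-|nxy]; last by rewrite sum_inc2_edges_neq // addn0.
rewrite adj_irr mul1n -sum_inc_vertex.
by apply: eq_bigr => e _; rewrite /inc mulnb andbb.
Qed.

(** The sum counts common vertices. Distinct edges share at most one, since two common endpoints
    would make them equal. *)
Lemma sum_inc2_vertices e f :
  \sum_x inc x e * inc x f = line_adj e f + (e == f) * 2.
Proof.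
have -> : \sum_x inc x e * inc x f = #|val e :&: val f|.
  rewrite -sum1_card [RHS]big_mkcond; apply: eq_bigr => x _.
  by rewrite /inc mulnb inE; case: (_ && _).
rewrite /line_adj; case: (eqVneq e f) => [<-|nef] /=; first by rewrite setIid card_edge.
rewrite addn0; case: eqP => [->|/eqP]; first by rewrite cards0.
rewrite -card_gt0 => ge1.
suff : #|val e :&: val f| < 2 by move: ge1; case: #|_| => [|[]].
rewrite -(card_edge e) proper_card // properEneq subsetIl andbT.
apply: contraNneq nef => E; rewrite -val_eqE eqEcard !card_edge andbT.
by rewrite -E subsetIr.
Qed.

Lemma handshake r : regular G r -> r * #|vertex G| = 2 * #|edge G|.
Proof.
move=> rG; have: \sum_x \sum_e inc x e = \sum_e \sum_x inc x e by rewrite exchange_big.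
under eq_bigr => x _ do rewrite sum_inc_vertex rG.
under [RHS]eq_bigr => e _ do rewrite sum_inc_edge.
by rewrite !sum_nat_const mulnC => ->; rewrite mulnC.
Qed.

(** The row of [B^T B] at e sums to 2 r, and its diagonal entry 2 has to be removed. *)
Lemma regular_line_graph r : regular G r -> regular (line_graph G) (2 * r - 2).
Proof.
move=> rG e.
have: \sum_f \sum_x inc x e * inc x f = 2 * r.
  rewrite exchange_big /= -(sum_inc_edge e) big_distrl; apply: eq_bigr => x _.
  by rewrite -big_distrr /= sum_inc_vertex rG.
under eq_bigr => f _ do rewrite sum_inc2_vertices.
have D : \sum_f (e == f) * 2 = 2.
  by rewrite (bigD1 e) //= eqxx big1 // => f; rewrite eq_sym => /negbTE->.
by rewrite big_split /= D => <-; rewrite addnK.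
Qed.

End Incidence.

(** * Eigenvalues of the products M N and N M *)

Section EigenProducts.
Variable F : fieldType.

(** An eigenvector v yields [v *m M], which is nonzero because multiplying it by N returns a v with
    a nonzero. *)
Lemma eigenvalue_mulmx_sub p q (M : 'M[F]_(p, q)) (N : 'M[F]_(q, p)) a :
  a != 0 -> eigenvalue (M *m N) a -> eigenvalue (N *m M) a.
Proof.
move=> a0 /eigenvalueP[v vE v0]; apply/eigenvalueP; exists (v *m M).
  by rewrite mulmxA -(mulmxA v) vE -scalemxAl.
apply: contraNneq v0 => vM0; move: vE.
rewrite mulmxA vM0 mul0mx => /esym/eqP; rewrite scaler_eq0 (negbTE a0).
by [].
Qed.

Lemma eigenvalue_mulmxC p q (M : 'M[F]_(p, q)) (N : 'M[F]_(q, p)) a :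
  a != 0 -> eigenvalue (M *m N) a = eigenvalue (N *m M) a.
Proof. by move=> a0; apply/idP/idP; apply: eigenvalue_mulmx_sub. Qed.

Lemma eigenvalue0_mulmx p q (M : 'M[F]_(p, q)) (N : 'M[F]_(q, p)) :
  (p < q)%N -> eigenvalue (N *m M) 0.
Proof.
move=> ltpq; rewrite /eigenvalue /eigenspace raddf0 subr0 kermx_eq0.
rewrite /row_free neq_ltn; apply/orP; left.
by apply: leq_ltn_trans (mulmx_max_rank _ _) ltpq.
Qed.

Lemma eigenvalue0_det p (M : 'M[F]_p) : eigenvalue M 0 = (\det M == 0).
Proof.
rewrite /eigenvalue /eigenspace raddf0 subr0 kermx_eq0 row_free_unit.
by rewrite unitmxE unitfE negbK.
Qed.

(** For a = 0 both determinants equal det M det N. The equality p = q is a hypothesis because the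
    sizes will be the numbers of vertices and edges. *)
Lemma eigenvalue_mulmxC_square p q (M : 'M[F]_(p, q)) (N : 'M[F]_(q, p)) a :
  p = q -> eigenvalue (M *m N) a = eigenvalue (N *m M) a.
Proof.
move=> Epq; subst q; have [->|a0] := eqVneq a 0; last exact: eigenvalue_mulmxC.
by rewrite !eigenvalue0_det !det_mulmx mulrC.
Qed.

Lemma eigenvalueD_scalar p (M : 'M[F]_p) a c :
  eigenvalue (M + c%:M) a = eigenvalue M (a - c).
Proof.
by rewrite /eigenvalue /eigenspace raddfB /= opprB addrA addrAC.
Qed.

End EigenProducts.

(** * The spectrum of the line graph of a regular graph *)

Section LineSpectrum.
Variables (F : fieldType) (G : sgraph) (r : nat).
Hypothesis rG : regular G r.

Let B : 'M[F]_(#|vertex G|, #|edge G|) :=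
  \matrix_(i, j) (inc (enum_val i) (enum_val j))%:R.

Let mulB_tr : B *m B^T = adjacency_matrix F G + (r%:R)%:M.
Proof.
apply/matrixP=> i j; rewrite !mxE.
under eq_bigr => k _ do rewrite !mxE -natrM.
rewrite -(big_enum_val
  (fun e : edge G => (inc (enum_val i) e * inc (enum_val j) e)%:R : F)).
rewrite -natr_sum sum_inc2_edges rG natrD (inj_eq enum_val_inj).
by case: (i == j); rewrite ?mul1n ?mul0n ?mulr1n ?mulr0n.
Qed.

Let mul_trB : B^T *m B = adjacency_matrix F (line_graph G) + (2%:R)%:M.
Proof.
apply/matrixP=> i j; rewrite !mxE.
under eq_bigr => k _ do rewrite !mxE -natrM.
rewrite -(big_enum_val
  (fun x : vertex G => (inc x (enum_val i) * inc x (enum_val j))%:R : F)).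
rewrite -natr_sum sum_inc2_vertices natrD (inj_eq enum_val_inj).
by case: (i == j); rewrite ?mul1n ?mul0n ?mulr1n ?mulr0n.
Qed.

Lemma eigenvalue_line_graph a : (2 < r)%N -> (0 < #|vertex G|)%N ->
  eigenvalue (adjacency_matrix F (line_graph G)) a
    = (a == - 2%:R) || eigenvalue (adjacency_matrix F G) (a + 2%:R - r%:R).
Proof.
move=> r3 V0; have := handshake rG => hs.
(* This follows from r |V| = 2 |E|, r >= 3 and |V| > 0; it makes 0 an eigenvalue of [B^T *m B],
   which accounts for -2. *)
have ltVE : (#|vertex G| < #|edge G|)%N by nia.
rewrite -[in LHS](addrK 2%:R a) -eigenvalueD_scalar -mul_trB.
rewrite -eigenvalueD_scalar -mulB_tr -addr_eq0.
have [->|a0] /= := eqVneq; first exact: eigenvalue0_mulmx.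
by rewrite eigenvalue_mulmxC.
Qed.

(** Here |V| = |E|, so B is square and the two products share the eigenvalue 0 as well; both shifts
    are by 2. *)
Lemma eigenvalue_line_graph2 a : r = 2%N ->
  eigenvalue (adjacency_matrix F (line_graph G)) a
    = eigenvalue (adjacency_matrix F G) a.
Proof.
move=> r2; have := handshake rG => hs.
rewrite -[in LHS](addrK 2%:R a) -eigenvalueD_scalar -mul_trB.
rewrite -(eigenvalue_mulmxC_square B); last by lia.
by rewrite mulB_tr r2 eigenvalueD_scalar addrK.
Qed.

End LineSpectrum.

(** Eigenvectors become functions on the vertices, free of the enumeration; symmetry of [adj] turns
    the row action into neighbour sums. *)
Lemma eigenvalue_adjacencyP (F : fieldType) (G : sgraph) (a : F) :
  reflect (exists2 f : vertex G -> F,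
             forall x, \sum_(y | adj x y) f y = a * f x & exists x, f x != 0)
          (eigenvalue (adjacency_matrix F G) a).
Proof.
apply: (iffP eigenvalueP) => [[v vE v0]|[f fE [x fx0]]].
  exists (fun x => v 0 (enum_rank x)) => [x|].
    have /matrixP/(_ 0 (enum_rank x)) := vE; rewrite !mxE => <-.
    rewrite big_mkcond (reindex _ (onW_bij _ (enum_val_bij _))) /=.
    apply: eq_bigr => i _; rewrite mxE enum_valK enum_rankK adj_sym.
    by case: (adj _ _); rewrite ?mulr1 ?mulr0.
  have /rV0Pn[i vi] := v0.
  by exists (enum_val i); rewrite enum_valK.
exists (\row_i f (enum_val i)).
  apply/rowP=> j; rewrite !mxE -fE [RHS]big_mkcond.
  rewrite [RHS](reindex _ (onW_bij _ (enum_val_bij _))) /=.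
  apply: eq_bigr => i _; rewrite !mxE adj_sym.
  by case: (adj _ _); rewrite ?mulr1 ?mulr0.
by apply/rV0Pn; exists (enum_rank x); rewrite mxE enum_rankK.
Qed.

(** * The spectrum of the unitary Cayley graph *)

(** By the Chinese remainder theorem, take v congruent to k modulo the p-part of n and to 1 modulo
    the cofactor. *)
Lemma coprime_dvd_lift p n k :
    prime p -> (p %| n)%N -> (0 < n)%N -> coprime p k ->
  exists2 v, coprime n v & v = k %[mod p].
Proof.
move=> p_pr pn n0 pk; have [m pm nE] := pfactor_coprime p_pr n0.
have l0 : (0 < logn p n)%N by rewrite logn_gt0 mem_primes p_pr n0.
have cop : coprime (p ^ logn p n) m by rewrite coprime_pexpl.
exists (chinese (p ^ logn p n) m k 1).
  rewrite [X in coprime X _]nE coprimeMl; apply/andP; split.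
    by rewrite coprime_sym -coprime_modl chinese_modr // coprime_modl coprime1n.
  rewrite coprime_sym -coprime_modl chinese_modl // coprime_modl.
  by rewrite coprime_sym coprime_pexpl.
have dp : (p %| p ^ logn p n)%N by rewrite dvdn_exp.
by rewrite -(modn_dvdm _ dp) chinese_modl // modn_dvdm.
Qed.

(** Any root of 1 + X + ... + X^(p-1) works: at 1 this polynomial takes the value p, nonzero in
    characteristic 0. *)
Lemma nontrivial_root_of_unity (C : numClosedFieldType) p :
  prime p -> exists2 z : C, z ^+ p = 1 & z != 1.
Proof.
move=> p_pr; pose P : {poly C} := \poly_(i < p) 1.
have sP : size P = p by rewrite size_poly_eq // oner_neq0.
have /closed_rootP[z] : size P != 1%N by rewrite sP neq_ltn prime_gt1 ?orbT.
rewrite /root horner_poly; under eq_bigr => i _ do rewrite mul1r.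
move=> /eqP z0; exists z.
  by apply/eqP; rewrite -subr_eq0 subrX1 z0 mulr0.
apply/eqP => z1; move/eqP: z0; rewrite z1.
under eq_bigr => i _ do rewrite expr1n.
by rewrite sumr_const card_ord pnatr_eq0; case: p p_pr {P sP}.
Qed.

(** By Bezout a u = b p + 1, so z ^+ u = 1 would force z = 1. *)
Lemma root_of_unity_neq1 (F : fieldType) p (z : F) u :
  prime p -> z ^+ p = 1 -> z != 1 -> coprime p u -> z ^+ u != 1.
Proof.
move=> p_pr zp z1 pu; apply: contraNneq z1 => zu.
have u0 : (0 < u)%N.
  by case: u pu {zu} => //; rewrite /coprime gcdn0 => /eqP p1; rewrite p1 in p_pr.
have [a b /= E _] := egcdnP p u0.
move: pu; rewrite coprime_sym => /eqP g1.
have : z ^+ (a * u) = z ^+ (b * p + 1) by rewrite E g1.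
by rewrite mulnC exprM zu expr1n addn1 exprS mulnC exprM zp expr1n mulr1 => <-.
Qed.

Lemma sum_expr_root_of_unity (F : fieldType) p (z : F) :
  z ^+ p = 1 -> z != 1 -> \sum_(i < p) z ^+ i = 0.
Proof.
move=> zp z1; apply/eqP; move: (subrX1 z p); rewrite zp subrr => /esym/eqP.
by rewrite mulf_eq0 subr_eq0 (negbTE z1).
Qed.

Section UnitaryCayleySpectrum.
Variables (C : numClosedFieldType) (m : nat).
(** With the order written as [m.+2], the type ['I_n] is the ring Z/n. *)
Local Notation n := m.+2.
Local Notation A := (adjacency_matrix C (unitary_cayley n)).
Local Notation phi := (totient n)%:R.
Implicit Types (x y u v e : 'I_n) (a : C).

Lemma unit_ord_coprime u : (u \is a GRing.unit) = coprime n u.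
Proof. by rewrite -[in LHS](natr_Zp u) (@unitZpE n). Qed.

Lemma ucayley_adjE x y : ucayley_adj x y = (y - x \is a GRing.unit).
Proof.
rewrite unit_ord_coprime.
have -> : coprime n (y - x)%R = (gcdz (x%:Z - y%:Z) n%:Z == 1).
  have -> : x%:Z - y%:Z = - (y%:Z - x%:Z) by rewrite opprB.
  rewrite gcdNz gcdzC -(gcdzDl n%:Z).
  (* Subtraction in Z/n reduces y + (n - x) modulo n; adding n to the integer difference produces
     this natural number. *)
  have -> : n%:Z + (y%:Z - x%:Z) = (y + (n - x))%N%:Z by have := ltn_ord x; lia.
  rewrite /coprime /= modnDmr gcdn_modr eqz_nat.
  by [].
rewrite /ucayley_adj; case: (eqVneq x y) => [->|//].
by rewrite subrr gcd0z.
Qed.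

Lemma card_units : #|[pred u : 'I_n | u \is a GRing.unit]| = totient n.
Proof.
rewrite totient_count_coprime big_mkord -sum1_card big_mkcond /=.
by apply: eq_bigr => u _; rewrite inE unit_ord_coprime; case: coprime.
Qed.

Lemma sum_ucayley_adj (T : nmodType) (f : 'I_n -> T) x :
  \sum_(y | ucayley_adj x y) f y = \sum_(u | u \is a GRing.unit) f (x + u).
Proof.
rewrite (reindex (fun u => x + u)) /=; last first.
  by exists (fun y => y - x) => y _; [rewrite addrC addKr | rewrite addrC subrK].
by apply: eq_bigl => u; rewrite ucayley_adjE addrC addKr.
Qed.

Lemma regular_ucayley : regular (unitary_cayley n) (totient n).
Proof.
move=> x; rewrite /degree /= -card_units -sum1_card -big_mkcond /=.
exact: (sum_ucayley_adj (fun=> 1%N)).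
Qed.

Lemma ucayley_eigenP a :
  reflect (exists2 f : 'I_n -> C,
             forall x, \sum_(u | u \is a GRing.unit) f (x + u) = a * f x
             & exists x, f x != 0)
          (eigenvalue A a).
Proof.
apply: (iffP (eigenvalue_adjacencyP _ _)) => -[f fE f0]; exists f => // x.
  by rewrite -sum_ucayley_adj -fE.
by rewrite -fE [LHS]sum_ucayley_adj.
Qed.

Lemma sum_units_const a : \sum_(u : 'I_n | u \is a GRing.unit) a = phi * a.
Proof. by rewrite sumr_const card_units mulr_natl. Qed.

Lemma eigenvalue_totient : eigenvalue A phi.
Proof.
apply/ucayley_eigenP; exists (fun=> 1) => [x|]; first exact: sum_units_const.
by exists 0; rewrite oner_neq0.
Qed.

Lemma expr_addZp (z : C) x y : z ^+ n = 1 -> z ^+ (x + y)%R = z ^+ x * z ^+ y.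
Proof. by move=> zn; rewrite /= expr_mod // exprD. Qed.

Lemma expr_mulZp (z : C) x y : z ^+ n = 1 -> z ^+ (x * y)%R = z ^+ (x * y)%N.
Proof. by move=> zn; rewrite /= expr_mod. Qed.

(** For n even all units are odd, so X_n is bipartite and multiplying an eigenvector by (-1)^x
    negates its eigenvalue. *)
Lemma eigenvalue_ucayley_opp a : ~~ odd n -> eigenvalue A a -> eigenvalue A (- a).
Proof.
move=> n_even /ucayley_eigenP[f fE [y fy]]; apply/ucayley_eigenP.
have sn : (-1) ^+ n = 1 :> C by rewrite -signr_odd (negbTE n_even).
exists (fun x => (-1) ^+ x * f x); last first.
  by exists y; rewrite mulf_neq0 // signr_eq0.
move=> x; rewrite mulrCA mulNr -fE -sumrN mulr_sumr; apply: eq_bigr => u.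
rewrite unit_ord_coprime => nu; rewrite expr_addZp // -(signr_odd _ u).
have -> : odd u.
  by rewrite -coprime2n; apply: coprime_dvdl nu; rewrite dvdn2.
by rewrite expr1 mulrN1 mulNr mulrN.
Qed.

(* The character [x => z ^+ x] with z a nontrivial p-th root of unity. Each
   k in 1..p-1 lifts to a unit v of Z/n, and u => v u permutes the units, so
   the eigenvalue is unchanged when z is replaced by z ^+ k; summing over k
   gives (p - 1) c = - phi. *)
Lemma eigenvalue_prime_divisor p : prime p -> (p %| n)%N ->
  eigenvalue A (- phi / p.-1%:R).
Proof.
move=> p_pr pn; have [z zp z1] := nontrivial_root_of_unity C p_pr.
have p1 := prime_gt1 p_pr.
have zn : z ^+ n = 1 by case/dvdnP: pn => q ->; rewrite mulnC exprM zp expr1n.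
pose c k := \sum_(u : 'I_n | u \is a GRing.unit) z ^+ (k * u).
have cE k : coprime p k -> c k = c 1%N.
  move=> pk; have [v nv vk] := coprime_dvd_lift p_pr pn isT pk.
  have vU : (v%:R : 'I_n) \is a GRing.unit by rewrite (@unitZpE n).
  rewrite /c [RHS](reindex_inj (mulrI vU)).
  apply: eq_big => [u|u _]; first by rewrite unitrM vU.
  rewrite mul1n expr_mulZp //.
  rewrite (@val_Zp_nat n) // !exprM expr_mod //.
  by rewrite -(expr_mod v zp) vk expr_mod.
have c0 : c 0%N = phi by rewrite -[RHS]mulr1 -sum_units_const.
have cS : c 1%N * p.-1%:R = - phi.
  (* For a unit u, z ^+ u is again a nontrivial p-th root of unity, so its powers sum to 0. *)
  have : \sum_(k < p) c k = 0.
    rewrite exchange_big big1 //= => u; rewrite unit_ord_coprime => nu.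
    under eq_bigr => k _ do rewrite mulnC exprM.
    apply: sum_expr_root_of_unity; first by rewrite -exprM mulnC exprM zp expr1n.
    exact/root_of_unity_neq1/(coprime_dvdl pn nu).
  case: p p_pr p1 {pn zp} cE => // p p_pr p1 cE.
  rewrite big_ord_recl /= c0 => /eqP; rewrite addrC addr_eq0 => /eqP <-.
  rewrite mulr_natr -[in LHS](card_ord p) -sumr_const; apply: eq_bigr => i _.
  rewrite cE // prime_coprime // gtnNdvd //= /bump /=; have := ltn_ord i; lia.
rewrite -cS mulfK ?pnatr_eq0; last by case: p p1 {cE cS p_pr pn zp} => [|[]].
apply/ucayley_eigenP; exists (fun x => z ^+ x); last first.
  by exists 0; rewrite expr0 oner_neq0.
move=> x; rewrite mulr_suml; apply: eq_bigr => u _.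
by rewrite expr_addZp // mul1n mulrC.
Qed.

(** * Prime power order *)

Section PrimePower.
Variables p k : nat.
Hypotheses (p_pr : prime p) (nE : n = (p ^ k)%N).

Lemma unit_prime_power u : (u \is a GRing.unit) = ~~ (p %| u)%N.
Proof.
rewrite unit_ord_coprime [X in coprime X _]nE coprime_pexpl ?prime_coprime //.
by case: k nE.
Qed.

Lemma dvdn_addZp x y : (p %| (x + y)%R)%N = (p %| x + y)%N.
Proof.
rewrite /= /dvdn modn_dvdm // nE dvdn_exp //.
by case: k nE.
Qed.

Lemma unitD_prime_power u e : (p %| e)%N ->
  (u + e \is a GRing.unit) = (u \is a GRing.unit).
Proof. by move=> pe; rewrite !unit_prime_power dvdn_addZp dvdn_addl. Qed.

(** The vertices 0 and p have the same neighbours, and k > 1 keeps them distinct, so the difference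
    of their indicators is in the kernel. *)
Lemma eigenvalue0_prime_power : (1 < k)%N -> eigenvalue A 0.
Proof.
move=> k1; have p1 := prime_gt1 p_pr.
have ltpn : (p < n)%N by rewrite nE -[X in (X < _)%N]expn1 ltn_exp2l.
have e0 : (inord p : 'I_n) != 0 by rewrite -val_eqE /= inordK // -lt0n; lia.
apply/ucayley_eigenP; exists (fun x => (x == 0)%:R - (x == inord p)%:R).
  move=> x; rewrite mul0r sumrB; apply/eqP; rewrite subr_eq0; apply/eqP.
  rewrite [RHS](reindex (fun u => u + inord p)) /=; last first.
    by exists (fun u => u - inord p) => u _; rewrite ?addrK ?subrK.
  apply: eq_big => u; first by rewrite unitD_prime_power // inordK.
  by move=> _; rewrite addrA -[in RHS]subr_eq0 addrK.
by exists 0; rewrite eqxx [0 == inord p]eq_sym (negbTE e0) subr0 oner_neq0.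
Qed.

End PrimePower.

(** X_n is complete, so (a + 1) f x is the total sum of f for every x: either a = -1 or f is
    constant. *)
Lemma eigenvalue_prime a : prime n ->
  eigenvalue A a = (a \in [:: phi; -1]).
Proof.
move=> n_pr; rewrite !inE; apply/idP/orP => [|[]/eqP->].
- move=> /ucayley_eigenP[f fE [y fy]].
  have fS x : (a + 1) * f x = \sum_z f z.
    rewrite mulrDl mul1r -fE [RHS](reindex_inj (addrI x)) /= [RHS](bigD1 0) //=.
    rewrite addr0 addrC; congr (_ + _); apply: eq_bigl => u.
    rewrite (@unit_prime_power n 1) // ?expn1 //.
    rewrite -val_eqE /= -lt0n; have [->|u0] := posnP u; first by rewrite dvdn0.
    by rewrite gtnNdvd.
  have [E|a1] := eqVneq (a + 1) 0; first by right; rewrite -addr_eq0 E.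
  left; have fc x : f x = f y by apply: (mulfI a1); rewrite !fS.
  have := fE y; under eq_bigr => u _ do rewrite fc.
  by rewrite sum_units_const => /(mulIf fy) ->.
- exact: eigenvalue_totient.
- have := eigenvalue_prime_divisor n_pr (dvdnn _).
  by rewrite totient_prime // mulNr divff // pnatr_eq0.
Qed.

(** X_n is complete bipartite between even and odd residues. For a nonzero, an eigenvector depends
    only on parity, and two steps by 1 give a^2 = phi^2. *)
Lemma eigenvalue_power2 k a : n = (2 ^ k)%N -> (1 < k)%N ->
  eigenvalue A a = (a \in [:: phi; - phi; 0]).
Proof.
move=> nE k1; rewrite !inE.
have n_even : ~~ odd n by rewrite nE oddX; case: k k1 {nE}.
apply/idP/or3P => [|[]/eqP->]; last 3 first.
- exact: eigenvalue_totient.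
- exact/eigenvalue_ucayley_opp/eigenvalue_totient.
- exact: eigenvalue0_prime_power nE k1.
move=> /ucayley_eigenP[f fE [y fy]].
have [->|a0] := eqVneq a 0; first by constructor 3.
have fp x (e : 'I_n) : (2 %| e)%N -> f (x + e) = f x.
  move=> e2; apply: (mulfI a0); rewrite -!fE.
  rewrite [RHS](reindex_inj (addrI e)) /=; apply: eq_big => u.
    by rewrite [in RHS]addrC (unitD_prime_power _ nE).
  by rewrite addrA.
(* Units are odd, so x + u and x + 1 differ by an even residue. *)
have f1 (x : 'I_n) : a * f x = phi * f (x + 1).
  rewrite -fE -sum_units_const; apply: eq_bigr => u uU.
  rewrite -(fp (x + 1) (u - 1)) ?addrA ?addrK // -?addrA ?(addrC 1) ?subrK //.
  move: uU; rewrite (unit_prime_power _ nE) // => uU.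
  have := dvdn_addZp nE (u - 1) 1.
  by rewrite subrK (negbTE uU) (_ : nat_of_ord 1%R = 1%N) // !dvdn2 oddD; case: odd.
have : a * a * f y = phi * phi * f y.
  have f2 : f (y + 1 + 1) = f y by rewrite -addrA fp // (dvdn_addZp nE).
  by rewrite -mulrA f1 mulrCA f1 f2 mulrA.
move=> /(mulIf fy)/eqP; rewrite -!expr2 eqf_sqr => /orP[]->; by constructor.
Qed.


End UnitaryCayleySpectrum.

(** * The second line graph *)

(** The values 2 and -1 come from the degree and the prime 3, their negatives from bipartiteness;
    the recurrence around the cycle excludes others. *)
Lemma eigenvalue_ucayley6 (C : numClosedFieldType) (a : C) :
  eigenvalue (adjacency_matrix C (unitary_cayley 6)) a
    = (a \in [:: 2; -2; 1; -1]).
Proof.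
have t6 : totient 6 = 2%N by [].
have e2 := eigenvalue_totient C 4; rewrite t6 in e2.
have e1 : eigenvalue (adjacency_matrix C (unitary_cayley 6)) (-1).
  have := @eigenvalue_prime_divisor C 4 3 isT isT.
  by rewrite t6 mulNr divff ?pnatr_eq0.
rewrite !inE; apply/idP/idP; last first.
  case/or4P=> /eqP-> //; first exact: eigenvalue_ucayley_opp.
  by rewrite -(opprK 1); apply: eigenvalue_ucayley_opp.
move=> /ucayley_eigenP[f fE [x fx]].
have H y : f (y + 1) + f (y - 1) = a * f y.
  rewrite -fE (bigD1 1) ?unitr1 //= (bigD1 (-1)) ?unitrN1 //= big1 ?addr0 //.
  by move=> u; rewrite unit_ord_coprime -!val_eqE /=; case: u => -[|[|[|[|[|[]]]]]].
(* X_6 is a 6-cycle: iterating the recurrence three steps in both directions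
   from y reaches the antipode y + 3. *)
have H3 y : 2 * f (y + 3) = (a ^+ 3 - 3 * a) * f y.
  have p1 := H (y + 1); have m1 := H (y - 1).
  have p2 := H (y + 1 + 1); have m2 := H (y - 1 - 1).
  move: p1 m1 p2 m2; rewrite addrK subrK addrK subrK.
  have -> : y + 1 + 1 + 1 = y + 3 by rewrite -!addrA; congr (_ + _); apply: val_inj.
  have -> : y - 1 - 1 - 1 = y + 3 by rewrite -!addrA; congr (_ + _); apply: val_inj.
  move=> p1 m1 p2 m2.
  have E0 := H y.
  have E : a * (a * (a * f y)) = 2 * f (y + 3) + 3 * (a * f y).
    rewrite -E0 !mulrDr -p1 -m1 !mulrDr -p2 -m2 -E0; ring.
  have -> : (a ^+ 3 - 3 * a) * f y = a * (a * (a * f y)) - 3 * (a * f y) by ring.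
  by rewrite E addrK.
have x6 : x + 3 + 3 = x.
  by rewrite -addrA -[RHS]addr0; congr (_ + _); apply: val_inj.
(* Two steps by 3 return to x, so (a^3 - 3 a)^2 = 4 on f x; the difference of the two sides factors
   in this way. *)
have : ((a - 2) * (a + 2) * ((a - 1) * (a + 1)) ^+ 2) * f x = 0.
  have E1 := H3 x; have := H3 (x + 3); rewrite x6 => E2.
  have : 4 * f x = (a ^+ 3 - 3 * a) ^+ 2 * f x.
    have -> : 4 * f x = 2 * (2 * f x) by ring.
    by rewrite E2 mulrCA E1 expr2 mulrA.
  move/eqP; rewrite eq_sym -subr_eq0 => /eqP <-; ring.
move/eqP; rewrite mulf_eq0 (negbTE fx) orbF mulf_eq0 expf_eq0 !mulf_eq0 /=.
by rewrite !subr_eq0 !addr_eq0 -orbA.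
Qed.

(* Besides 1 and n - 1, a third unit is 2 if n is odd, n/2 - 1 if 4 | n, and
   n/2 - 2 otherwise. *)
Lemma totient_gt2 n : (4 < n)%N -> n != 6%N -> (2 < totient n)%N.
Proof.
move=> n4 n6; have [w nw /andP[w1 wn]] : exists2 w, coprime n w & (1 < w < n.-1)%N.
  have [n_odd|n_even] := boolP (odd n).
    by exists 2%N; rewrite ?coprimen2 //; lia.
  pose k := n./2; have nE : n = (2 * k)%N by rewrite /k; lia.
  have [k_odd|k_even] := boolP (odd k).
    exists (k - 2)%N; last by lia.
    rewrite nE coprimeMl coprime2n oddB ?k_odd /=; last by lia.
    have kE : k = (2 + (k - 2))%N by lia.
    rewrite coprime_sym /coprime {2}kE gcdnDr -/(coprime _ _) coprimen2.
    by rewrite oddB ?k_odd //; lia.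
  exists k.-1; last by lia.
  rewrite nE coprimeMl coprime2n; apply/andP; split; first by lia.
  have kE : k = (1 + k.-1)%N by lia.
  by rewrite coprime_sym /coprime {2}kE gcdnDr gcdn1.
rewrite totient_count_coprime.
have -> : (\sum_(0 <= d < n) coprime n d)%N
        = size [seq d <- index_iota 0 n | coprime n d].
  rewrite size_filter -sum1_count [RHS]big_mkcond; apply: eq_bigr => d _.
  by case: coprime.
apply: (@uniq_leq_size _ [:: 1%N; w; n.-1]) => [|d]; first by rewrite /= !inE; lia.
rewrite !inE mem_filter mem_index_iota => /or3P[]/eqP->.
- by rewrite coprimen1; lia.
- by rewrite nw; lia.
- by rewrite coprimenP /=; lia.
Qed.

Lemma distinct_eigenvalues_size (F : fieldType) m (A : 'M[F]_m) s k :
    uniq s -> (forall a, eigenvalue A a = (a \in s)) ->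
  has_exactly_distinct_eigenvalues A k <-> size s = k.
Proof.
move=> us sA; split=> [[s' [us' <- s'A]]|sk]; last by exists s.
by apply/perm_size/uniq_perm => // a; rewrite -sA s'A.
Qed.

(** * The second line graph of a regular graph *)

Section IteratedLineGraph.
Variables (C : numClosedFieldType) (G : sgraph) (r : nat).
Hypothesis rG : regular G r.
Local Notation L2 := (line_graph (line_graph G)).

(** The line graph has degree 2 r - 2 = 0 (truncated for r = 0), hence no edges, and the matrix is
    empty. *)
Lemma eigenvalue_line2_deg_le1 (a : C) : (r <= 1)%N ->
  eigenvalue (adjacency_matrix C L2) a = false.
Proof.
move=> r1; apply/idP => aL; have [_ _ [e _]] := eigenvalue_adjacencyP _ _ aL.
have := handshake (regular_line_graph rG).
have : (0 < #|edge (line_graph G)|)%N by apply/card_gt0P; exists e.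
nia.
Qed.

Lemma eigenvalue_line2_deg2 (a : C) : r = 2%N ->
  eigenvalue (adjacency_matrix C L2) a = eigenvalue (adjacency_matrix C G) a.
Proof.
move=> r2; rewrite (eigenvalue_line_graph2 (regular_line_graph rG)) ?r2 //.
by rewrite (eigenvalue_line_graph2 rG).
Qed.

Hypotheses (r3 : (2 < r)%N) (V0 : (0 < #|vertex G|)%N).

(** Here t = a - (3 r - 6) for a in the spectrum of [L2]: 4 - 3 r is the -2 added by the outer line
    graph, and - r the -2 added by the inner one. *)
Definition shifted_spectrum (t : C) :=
  [|| t == 4 - 3 * r%:R, t == - r%:R | eigenvalue (adjacency_matrix C G) t].

Lemma eigenvalue_line2 (a : C) :
  eigenvalue (adjacency_matrix C L2) a = shifted_spectrum (a - (3 * r%:R - 6)).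
Proof.
have hs := handshake rG.
have E0 : (0 < #|edge G|)%N by nia.
rewrite (eigenvalue_line_graph (regular_line_graph rG)) //; last by lia.
rewrite (eigenvalue_line_graph rG) // /shifted_spectrum.
have -> : (2 * r - 2)%:R = 2 * r%:R - 2 :> C by rewrite natrB ?natrM; last by lia.
have eq_shift (x y z w : C) : x - y = z - w -> (x == y) = (z == w).
  by move=> E; rewrite -subr_eq0 E subr_eq0.
congr (_ || _); last congr (_ || _).
- by apply: eq_shift; ring.
- by apply: eq_shift; ring.
- by congr (eigenvalue _ _); ring.
Qed.

Lemma distinct_line2 s k : uniq s -> shifted_spectrum =1 mem s ->
  has_exactly_distinct_eigenvalues (adjacency_matrix C L2) k <-> size s = k.
Proof.
move=> us sS; pose h t : C := t + (3 * r%:R - 6).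
rewrite -(size_map h); apply: distinct_eigenvalues_size.
  by rewrite map_inj_uniq //; apply: addIr.
move=> a; rewrite eigenvalue_line2 sS /= -(mem_map (f := h)); last exact: addIr.
by rewrite /h subrK.
Qed.

Lemma distinct_line2_ge s k : uniq s -> all shifted_spectrum s ->
  has_exactly_distinct_eigenvalues (adjacency_matrix C L2) k -> (size s <= k)%N.
Proof.
move=> us /allP sS [s' [us' <- s'E]]; pose h t : C := t + (3 * r%:R - 6).
rewrite -(size_map h); apply: uniq_leq_size.
  by rewrite map_inj_uniq //; apply: addIr.
by move=> _ /mapP[t ts ->]; rewrite -s'E eigenvalue_line2 /h addrK sS.
Qed.

End IteratedLineGraph.

Lemma uniq_fractions (F : numFieldType) (d : nat) (s : seq int) :
  (0 < d)%N -> uniq [seq z%:~R / d%:R : F | z <- s] = uniq s.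
Proof.
move=> d0; apply: map_inj_uniq => y z /mulIf E.
by apply/eqP; rewrite -(eqr_int F) E // invr_eq0 pnatr_eq0 -lt0n.
Qed.

(** * Orders with at least five eigenvalues *)

Section Exclusions.
Variables (C : numClosedFieldType) (m : nat).
Local Notation n := m.+2.
Local Notation r := (totient n).
Local Notation Q := (@shifted_spectrum C (unitary_cayley n) r).
Local Notation four_eigenvalues := (has_exactly_distinct_eigenvalues
  (adjacency_matrix C (line_graph (line_graph (unitary_cayley n)))) 4).
Hypotheses (n4 : (4 < n)%N) (n6 : n != 6%N).

Let r3 : (2 < r)%N. Proof. exact: totient_gt2. Qed.

Let V0 : (0 < #|vertex (unitary_cayley n)|)%N. Proof. by rewrite card_ord. Qed.

(* The distinct values are compared over a common denominator, in int, because
   C is only partially ordered. *)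
Let not_four_of_fractions (d : nat) (s : seq int) :
    (0 < d)%N -> uniq s -> size s = 5%N ->
  all Q [seq z%:~R / d%:R | z <- s] -> ~ four_eigenvalues.
Proof.
move=> d0 us s5 sQ H.
have := distinct_line2_ge (@regular_ucayley m) r3 V0 _ sQ H.
by rewrite uniq_fractions // size_map s5 => /(_ us).
Qed.

Let Qeig t : eigenvalue (adjacency_matrix C (unitary_cayley n)) t -> Q t.
Proof. by rewrite /shifted_spectrum => ->; rewrite !orbT. Qed.

Let Qr : Q r%:R. Proof. exact/Qeig/eigenvalue_totient. Qed.
Let Qnr : Q (- r%:R). Proof. by rewrite /shifted_spectrum eqxx orbT. Qed.
Let Q43 : Q (4 - 3 * r%:R). Proof. by rewrite /shifted_spectrum eqxx. Qed.

Let Qp p : prime p -> (p %| n)%N -> Q (- r%:R / p.-1%:R).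
Proof. by move=> p_pr pn; apply/Qeig/eigenvalue_prime_divisor. Qed.

(** The five values are 4 - 3 r < - r < - r/(p-1) < r/(p-1) < r, in this order because r >= 3 and p
    - 1 >= 2; all are scaled by p - 1. *)
Lemma not_four_eigenvalues_even p :
  ~~ odd n -> prime p -> (p %| n)%N -> (2 < p)%N -> ~ four_eigenvalues.
Proof.
move=> n_even p_pr pn p2.
pose P := p.-1; pose R := r.
have P2 : (1 < P)%N by rewrite /P; lia.
have P0 : P%:R != 0 :> C by rewrite pnatr_eq0; lia.
have R3 : (2 < R)%N by [].
apply: (@not_four_of_fractions P [:: R%:Z * P%:Z; - (R%:Z * P%:Z); - R%:Z; R%:Z;
                      4 * P%:Z - 3 * (R%:Z * P%:Z)]) => //; first by lia.
  have h1 : (R%:Z * P%:Z >= 2 * R%:Z) by nia.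
  have h2 : (R%:Z * P%:Z >= 3 * P%:Z) by nia.
  move: h1 h2; set X := R%:Z * P%:Z => h1 h2.
  by rewrite /= !inE; lia.
have e1 := Qp p_pr pn.
have e2 : Q (r%:R / p.-1%:R).
  apply: Qeig; rewrite -[_ / _]opprK -mulNr.
  exact/eigenvalue_ucayley_opp/eigenvalue_prime_divisor.
rewrite /= !(rmorphD, rmorphN, rmorphM) /= -!pmulrn.
rewrite !mulNr mulfK // mulrBl !mulfK // mulrA mulfK //.
by rewrite Qr Qnr Q43 -mulNr e1 e2.
Qed.

(** The fifth value is - r/(q-1); the common denominator is (p-1)(q-1). *)
Lemma not_four_eigenvalues_two_primes p q :
  prime p -> prime q -> (p %| n)%N -> (q %| n)%N ->
  (2 < p)%N -> (2 < q)%N -> p != q -> ~ four_eigenvalues.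
Proof.
move=> p_pr q_pr pn qn p2 q2 npq.
pose P := p.-1; pose P' := q.-1; pose R := r.
have P2 : (1 < P)%N by rewrite /P; lia.
have P'2 : (1 < P')%N by rewrite /P'; lia.
have P0 : P%:R != 0 :> C by rewrite pnatr_eq0; lia.
have P'0 : P'%:R != 0 :> C by rewrite pnatr_eq0; lia.
have R3 : (2 < R)%N by [].
have nP : P != P' by rewrite /P /P'; lia.
apply: (@not_four_of_fractions (P * P')
  [:: R%:Z * (P%:Z * P'%:Z); - (R%:Z * (P%:Z * P'%:Z));
   - (R%:Z * P'%:Z); - (R%:Z * P%:Z);
   4 * (P%:Z * P'%:Z) - 3 * (R%:Z * (P%:Z * P'%:Z))]) => //; first by nia.
  have h1 : (R%:Z * (P%:Z * P'%:Z) >= 2 * (R%:Z * P%:Z)) by nia.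
  have h2 : (R%:Z * (P%:Z * P'%:Z) >= 2 * (R%:Z * P'%:Z)) by nia.
  have h3 : (R%:Z * (P%:Z * P'%:Z) >= 3 * (P%:Z * P'%:Z)) by nia.
  have h4 : (P%:Z * P'%:Z > 0) by nia.
  have h5 : R%:Z * P'%:Z != R%:Z * P%:Z by nia.
  have h6 : R%:Z * P'%:Z > 0 by nia.
  have h7 : R%:Z * P%:Z > 0 by nia.
  move: h1 h2 h3 h4 h5 h6 h7.
  move: (R%:Z * (P%:Z * P'%:Z)) (R%:Z * P%:Z) (R%:Z * P'%:Z) (P%:Z * P'%:Z).
  by move=> X Y Z W *; rewrite /= !inE; lia.
have e1 := Qp p_pr pn; have e2 := Qp q_pr qn.
rewrite /= !(rmorphD, rmorphN, rmorphM) /= -!pmulrn ?natrM.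
rewrite [X in Q X](_ : _ = r%:R); last by field; rewrite P0 P'0.
rewrite [X in _ && (Q X && _)](_ : _ = - r%:R); last by field; rewrite P0 P'0.
rewrite [X in _ && (_ && (Q X && _))](_ : _ = - r%:R / p.-1%:R);
  last by rewrite -/P; field; rewrite P0 P'0.
rewrite [X in _ && (_ && (_ && (Q X && _)))](_ : _ = - r%:R / q.-1%:R);
  last by rewrite -/P'; field; rewrite P0 P'0.
rewrite [X in _ && (_ && (_ && (_ && (Q X && _))))](_ : _ = 4 - 3 * r%:R);
  last by rewrite /R; field; rewrite P0 P'0.
by rewrite Qr Qnr Q43 e1 e2.
Qed.

(** Here 0 replaces the value r/(p-1) of the even case. *)
Lemma not_four_eigenvalues_prime_power p k :
  prime p -> n = (p ^ k)%N -> (2 < p)%N -> (1 < k)%N -> ~ four_eigenvalues.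
Proof.
move=> p_pr nE p2 k1.
pose P := p.-1; pose R := r.
have P2 : (1 < P)%N by rewrite /P; lia.
have P0 : P%:R != 0 :> C by rewrite pnatr_eq0; lia.
have R3 : (2 < R)%N by [].
apply: (@not_four_of_fractions P [:: R%:Z * P%:Z; - (R%:Z * P%:Z); - R%:Z; 0;
                      4 * P%:Z - 3 * (R%:Z * P%:Z)]) => //; first by lia.
  have h1 : (R%:Z * P%:Z >= 2 * R%:Z) by nia.
  have h2 : (R%:Z * P%:Z >= 3 * P%:Z) by nia.
  move: h1 h2; set X := R%:Z * P%:Z => h1 h2.
  by rewrite /= !inE; lia.
have pn : (p %| n)%N by rewrite nE dvdn_exp //; lia.
have e1 := Qp p_pr pn.
have e2 : Q 0 by apply/Qeig/(eigenvalue0_prime_power C p_pr nE k1).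
rewrite /= !(rmorphD, rmorphN, rmorphM) /= -!pmulrn mul0r.
rewrite !mulNr mulfK // mulrBl !mulfK // mulrA mulfK //.
by rewrite Qr Qnr Q43 -mulNr e1 e2.
Qed.

End Exclusions.

(** * Orders with exactly four eigenvalues *)

Section Inclusions.
Variables (C : numClosedFieldType) (m : nat).
Local Notation n := m.+2.
Local Notation r := (totient n).
Local Notation L2 := (line_graph (line_graph (unitary_cayley n))).
Local Notation four_eigenvalues :=
  (has_exactly_distinct_eigenvalues (adjacency_matrix C L2) 4).
Hypotheses (n4 : (4 < n)%N) (n6 : n != 6%N).

(** The integer z stands for the eigenvalue of X_n other than r and - r: -1 for n prime, 0 for a
    power of 2. *)
Let four_from_int (z : int) : z \notin [:: 4 - 3 * r%:Z; - r%:Z; r%:Z] ->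
  (forall t, @shifted_spectrum C (unitary_cayley n) r t
               = (t \in [:: 4 - 3 * r%:R; - r%:R; r%:R; z%:~R])) ->
  four_eigenvalues.
Proof.
move=> zr sE; have r3 := totient_gt2 n4 n6.
have V0 : (0 < #|vertex (unitary_cayley n)|)%N by rewrite card_ord.
suff us : uniq [:: 4 - 3 * r%:R; - r%:R; r%:R; z%:~R : C].
  by have [_] := distinct_line2 (@regular_ucayley m) r3 V0 4 us sE; apply.
rewrite (_ : [:: _; _; _; _] =
    [seq w%:~R / 1%:R | w <- [:: 4 - 3 * r%:Z; - r%:Z; r%:Z; z]]).
  rewrite uniq_fractions //; move: zr r3; rewrite /= !inE.
  by move: (totient _) => R; lia.
by rewrite /= !divr1 rmorphB rmorphM rmorphN /= -!pmulrn.
Qed.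

Lemma four_eigenvalues_prime : prime n -> four_eigenvalues.
Proof.
move=> n_pr; have r3 := totient_gt2 n4 n6; apply: (@four_from_int (-1)).
  by move: r3; rewrite !inE; move: (totient _) => R; lia.
by move=> t; rewrite /shifted_spectrum eigenvalue_prime // !inE.
Qed.

Lemma four_eigenvalues_power2 k : n = (2 ^ k)%N -> four_eigenvalues.
Proof.
move=> nE; have r3 := totient_gt2 n4 n6; apply: (@four_from_int 0).
  by move: r3; rewrite !inE; move: (totient _) => R; lia.
have k1 : (1 < k)%N.
  by apply: (@leq_trans 3) => //; rewrite -(ltn_exp2l 2 k (isT : (1 < 2)%N)) -nE.
move=> t; rewrite /shifted_spectrum (eigenvalue_power2 _ nE k1) !inE.
by rewrite mulr0z; do 3!case: (t == _).
Qed.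

End Inclusions.

(** * The classification *)

Lemma prime_divisor_neq (p n : nat) : (0 < n)%N -> ~~ p.-nat n ->
  exists q, [/\ prime q, (q %| n)%N & q != p].
Proof.
rewrite /pnat => -> /= /allPn[q]; rewrite mem_primes => /and3P[q_pr _ qn] qp.
by exists q.
Qed.

Theorem theorem4p10 (C : numClosedFieldType) (n : nat) (n_gt0 : (0 < n)%N) :
  has_exactly_distinct_eigenvalues
    (adjacency_matrix C (line_graph (line_graph (unitary_cayley n)))) 4
  <-> (prime n /\ (3 < n)%N)
      \/ ((exists k : nat, n = (2 ^ k)%N) /\ (4 < n)%N)
      \/ n = 6%N.
Proof.
(* Serves n = 3, 4 and 6, where phi(n) = 2 and the eigenvalues to count are those of X_n. *)
have deg2 k s : totient k.+2 = 2%N -> uniq s ->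
    (forall a, eigenvalue (adjacency_matrix C (unitary_cayley k.+2)) a = (a \in s)) ->
    has_exactly_distinct_eigenvalues
      (adjacency_matrix C (line_graph (line_graph (unitary_cayley k.+2)))) 4
    <-> size s = 4%N.
  move=> t2 us sE; apply: distinct_eigenvalues_size us _ => a.
  by rewrite (eigenvalue_line2_deg2 (@regular_ucayley k) _ t2) sE.
have u6 : uniq [:: 2; -2; 1; -1 : C].
  rewrite (_ : [:: _; _; _; _] = [seq w%:~R / 1%:R | w <- [:: 2; -2; 1; -1]]).
    by rewrite uniq_fractions.
  by rewrite /= !divr1 !rmorphN.
split; last first.
  case=> [[n_pr n3]|[[[k nE] n4]|->]].
  - have n4 : (4 < n)%N by rewrite ltn_neqAle n3 andbT; case: eqP n_pr => // <-.
    have n6 : n != 6%N by case: eqP n_pr => // ->.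
    by case: n n_gt0 n_pr n4 n6 {n3} => [|[|m]] // _ *; apply: four_eigenvalues_prime.
  - have n6 : n != 6%N.
      apply/eqP => n6; move: nE; rewrite n6.
      by case: k => [|[|[|k]]] //; rewrite !expnS; lia.
    by case: n n_gt0 nE n4 n6 => [|[|m]] // _ nE *; apply: four_eigenvalues_power2 nE.
  - by apply/(deg2 4%N _ _ u6) => // a; apply: eigenvalue_ucayley6.
(* Serves n = 1 and 2, where the spectrum is empty. *)
have deg1 k r : (r <= 1)%N -> regular (unitary_cayley k) r ->
    ~ has_exactly_distinct_eigenvalues
        (adjacency_matrix C (line_graph (line_graph (unitary_cayley k)))) 4.
  move=> r1 rk; have E a := @eigenvalue_line2_deg_le1 C _ _ rk a r1.
  by move=> H4; have [/(_ H4)] := @distinct_eigenvalues_size _ _ _ [::] 4 isT E.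
case: n n_gt0 => [|[|m]] // _ H.
  (* X_1 has degree 0, although phi(1) = 1. *)
  case: (deg1 1%N 0%N isT _ H) => x.
  by rewrite /degree big1 //= => y _; rewrite /ucayley_adj !ord1 eqxx.
have n2 : m.+2 != 2%N.
  by apply/eqP=> -[m0]; rewrite m0 in H; exact: deg1 (@regular_ucayley 0) H.
have n3 : m.+2 != 3%N.
  apply/eqP=> -[m1]; rewrite m1 in H.
  have e3 a := @eigenvalue_prime C 1 a isT.
  have [|/(_ H)] // := deg2 1%N _ erefl _ e3.
  by rewrite /= !inE andbT -subr_eq0 opprK natr1 pnatr_eq0.
have n_neq4 : m.+2 != 4%N.
  apply/eqP=> -[m2]; rewrite m2 in H.
  have e4 a := @eigenvalue_power2 C 2 2 a erefl isT.
  have [|/(_ H)] // := deg2 2%N _ erefl _ e4.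
  rewrite /= !inE andbT oppr_eq0 pnatr_eq0 orbF andbT.
  by rewrite -subr_eq0 opprK -natrD pnatr_eq0.
have n4 : (4 < m.+2)%N by lia.
have [->|n6] := eqVneq m.+2 6%N; first by right; right.
have [n_pr|n_npr] := boolP (prime m.+2); first by left; split=> //; lia.
(* An even n that is not a power of 2 has an odd prime divisor. *)
have [n_odd|n_even] := boolP (odd m.+2); last first.
  have [/p_natP[k nE]|/(prime_divisor_neq (ltn0Sn m.+1))[q [q_pr qn q2]]] :=
    boolP (2%N.-nat m.+2).
    by right; left; split=> //; exists k.
  have q2' : (2 < q)%N by have := prime_gt1 q_pr; lia.
  by case: (not_four_eigenvalues_even n4 n6 n_even q_pr qn q2' H).
(* For n odd and composite, either n is a proper power of its least prime divisor or a second odd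
   prime divides it. *)
have p_pr := pdiv_prime (isT : (1 < m.+2)%N); have pn := pdiv_dvd m.+2.
have odd_dvd q : prime q -> (q %| m.+2)%N -> (2 < q)%N.
  move=> q_pr qn; have := dvdn_odd qn n_odd.
  by case: q q_pr {qn} => [|[|[|q]]].
have [/p_natP[k nE]|/(prime_divisor_neq (ltn0Sn m.+1))[q [q_pr qn qp]]] :=
  boolP ((pdiv m.+2).-nat m.+2).
  have k1 : (1 < k)%N.
    by move: n_npr; rewrite {1}nE; case: k nE => [|[|k]] nE; rewrite ?expn1 ?p_pr.
  by case: (not_four_eigenvalues_prime_power n4 n6 p_pr nE (odd_dvd _ p_pr pn) k1 H).
by case: (not_four_eigenvalues_two_primes n4 n6 q_pr p_pr qn pn
            (odd_dvd _ q_pr qn) (odd_dvd _ p_pr pn) qp H).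
Qed.
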